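(* Let $A\in\mathbb{C}^{n\times n}$ and let $m$ be the minimal polynomial of $A$. Then for generic $u,v\in\mathbb{C}^n$ there are at most $2\deg m-2$ values of the parameter $\tau\in\mathbb{C}$ for which there exists an eigenvalue of $A+\tau uv^\top$ of (algebraic) multiplicity at least two which is not an eigenvalue of $A$.
   Context: A subset $\Omega\subseteq\mathbb{C}^N$ is called generic if $\Omega$ is nonempty and its complement $\mathbb{C}^N\setminus\Omega$ is contained in a (complex) algebraic set which is not $\mathbb{C}^N$. The phrase ''Let $A\in\mathbb{C}^{n\times n}$. Then for generic $u,v\in\mathbb{C}^n$ ...'' means: for every $A\in\mathbb{C}^{n\times n}$ there exists a generic subset $\Omega$ of $\mathbb{C}^{2n}$, possibly dependent on $A$, such that for all $(u,v)\in\Omega$ the stated property holds. *)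

(* Defs.v *)
From mathcomp Require Export all_boot all_order all_algebra.
From mathcomp Require Export complex mpoly.
From mathcomp Require Export classical_sets functions cardinality reals.

Set Implicit Arguments.
Unset Strict Implicit.
Unset Printing Implicit Defensive.

Import Order.TTheory GRing.Theory Num.Theory.

Local Open Scope classical_set_scope.
Local Open Scope ring_scope.

Definition algebraic_set (F : fieldType) (N : nat) (Z : set 'cV[F]_N) : Prop :=
  exists P : set {mpoly F[N]},
    Z = [set x : 'cV[F]_N | forall p, P p -> p.@[fun i => x i 0] = 0].

Definition generic (F : fieldType) (N : nat) (Omega : set 'cV[F]_N) : Prop :=
  Omega !=set0 /\
  exists Z : set 'cV[F]_N,
    [/\ algebraic_set Z, Z <> [set: 'cV[F]_N] & ~` Omega `<=` Z].

(* Main.v *)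
Require Import Defs.
From mathcomp Require Import ring zify.

Set Implicit Arguments.
Unset Strict Implicit.
Unset Printing Implicit Defensive.

Import Order.TTheory GRing.Theory Num.Theory.

Local Open Scope classical_set_scope.
Local Open Scope card_scope.
Local Open Scope ring_scope.

(** Why the bound holds.  Let m be the minimal polynomial of A, of degree d,
    and let chi be its characteristic polynomial.  Off the spectrum of A, the
    resolvent (x - A)^-1 is B(x) / m(x) for a matrix B of polynomials of degree
    less than d, so with the scalar polynomial w = v^T B u the rank-one
    determinant formula gives

      char_poly (A + tau u v^T) = chi * (1 - tau (w / m)),

    which is [annihilator_char_poly_rank1] once denominators are cleared.  At a
    point x that is not an eigenvalue of A, chi and m do not vanish, so a
    multiple eigenvalue x is exactly a double root of the pencil m - tau w.
    This forces tau = m(x) / w(x) and makes x a critical point of m / w, that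
    is, a root of the Wronskian W = m w' - m' w ([double_root_pencil]).  Hence
    there are at most as many such tau as roots of W.

    Since w has leading coefficient v^T u in degree d - 1
    ([resolvent_form_top]), the coefficient of W in degree 2 d - 2 is
    (d - 1) v^T u - d v^T u = - v^T u.  If v^T u is nonzero, W is thus a nonzero
    polynomial of degree at most 2 d - 2 ([size_wronskian]).  The nonvanishing
    of v^T u is the only genericity condition, and it does not depend on A. *)

(** * Rank-one updates of a determinant *)

(** Two triangular eliminations of the bordered matrix [M u; v 1] compute its
    determinant as either side.  The second one uses the adjugate instead of
    the inverse, which costs a factor [\det M], whence the hypothesis. *)
Lemma det_sub_rank1 (R : idomainType) (n : nat) (M : 'M[R]_n)
    (u : 'cV[R]_n) (v : 'rV[R]_n) :
  \det M != 0 -> \det (M - u *m v) = \det M - (v *m \adj M *m u) 0 0.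
Proof.
move=> detM0; pose S := block_mx M u v (1%:M : 'M_1).
have detS : \det S = \det (M - u *m v).
  have: \det (S *m block_mx 1%:M 0 (- v) 1%:M) = \det (M - u *m v).
    rewrite mulmx_block !mulmx1 !mul1mx !mulmx0 !add0r mulmxN subrr.
    by rewrite det_ublock det1 mulr1.
  by rewrite det_mulmx det_lblock !det1 !mulr1.
have: \det (block_mx 1%:M 0 (- (v *m \adj M)) (\det M)%:M *m S)
      = \det M * (\det M - (v *m \adj M *m u) 0 0).
  rewrite mulmx_block !mul1mx !mul0mx !addr0 !mulNmx -[v *m _ *m M]mulmxA.
  rewrite mul_adj_mx.
  rewrite mul_mx_scalar mul_scalar_mx addNr mulmx1 det_ublock det_mx11.
  by rewrite !mxE mulr1n addrC.
rewrite det_mulmx det_lblock det1 mul1r det_scalar1 detS.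
exact: (mulfI detM0).
Qed.

(** * The resolvent with an annihilating polynomial as denominator *)

(** The divided difference (p(X) - p(A)) / (X - A), written out with the
    factorisation of X^j - A^j.  When p annihilates A, it is the numerator of
    the resolvent (X - A)^-1 over the denominator p. *)
Definition resolvent_numer (F : fieldType) (n : nat) (A : 'M[F]_n.+1)
    (p : {poly F}) : 'M[{poly F}]_n.+1 :=
  \sum_(j < size p) (p`_j)%:P *:
    (\sum_(i < j) 'X%:M ^+ (j.-1 - i) * map_mx polyC A ^+ i).

Lemma mul_resolvent_numer (F : fieldType) (n : nat) (A : 'M[F]_n.+1)
    (p : {poly F}) :
  char_poly_mx A *m resolvent_numer A p
  = p%:M - map_mx polyC (horner_mx A p).
Proof.
have -> : horner_mx A p = \sum_(j < size p) p`_j *: A ^+ j.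
  rewrite -{1}[p]coefK poly_def rmorph_sum; apply: eq_bigr => j _ /=.
  by rewrite linearZ /= rmorphXn /= horner_mx_X.
have -> : p%:M = \sum_(j < size p) (p`_j)%:P *: 'X%:M ^+ j
    :> 'M[{poly F}]_n.+1.
  rewrite -{1}[p]coefK poly_def rmorph_sum; apply: eq_bigr => j _ /=.
  by rewrite -mul_polyC rmorphM rmorphXn /= -mul_scalar_mx.
rewrite [map_mx _ _](raddf_sum (map_mx polyC)) -sumrB mulmx_sumr.
apply: eq_bigr => j _ /=.
rewrite -scalemxAr map_mxZ rmorphXn -scalerBr; congr (_ *: _).
rewrite subrXX_comm //.
exact: comm_scalar_mx.
Qed.

Definition resolvent_form (F : fieldType) (n : nat) (A : 'M[F]_n.+1)
    (u v : 'cV[F]_n.+1) (p : {poly F}) : {poly F} :=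
  (map_mx polyC v^T *m resolvent_numer A p *m map_mx polyC u) 0 0.

Lemma resolvent_formE (F : fieldType) (n : nat) (A : 'M[F]_n.+1)
    (u v : 'cV[F]_n.+1) (p : {poly F}) :
  resolvent_form A u v p =
  \sum_(j < size p) p`_j *:
    (\sum_(i < j) (v^T *m A ^+ i *m u) 0 0 *: 'X^(j.-1 - i)).
Proof.
rewrite /resolvent_form /resolvent_numer mulmx_sumr mulmx_suml summxE.
apply: eq_bigr => j _.
rewrite -scalemxAr -scalemxAl mxE mul_polyC; congr (_ *: _).
rewrite mulmx_sumr mulmx_suml summxE; apply: eq_bigr => i _.
rewrite -rmorphXn -rmorphXn /= -mulmxE mul_scalar_mx -scalemxAr -scalemxAl.
by rewrite -!map_mxM !mxE mulrC mul_polyC.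
Qed.

(** The top coefficient comes from the single term j = e + 1, i = 0 of
    [resolvent_formE]; it is the first moment in the expansion of
    v^T (x - A)^-1 u at infinity. *)
Lemma resolvent_form_top (F : fieldType) (n : nat) (A : 'M[F]_n.+1)
    (u v : 'cV[F]_n.+1) (p : {poly F}) (e : nat) :
  p \is monic -> size p = e.+2 ->
  (size (resolvent_form A u v p) <= e.+1)%N /\
  (resolvent_form A u v p)`_e = (v^T *m u) 0 0.
Proof.
move=> /monicP lp sp; have pe : p`_e.+1 = 1 by rewrite -lp lead_coefE sp.
rewrite resolvent_formE sp; split.
  apply: (leq_trans (size_sum _ _ _)); apply/bigmax_leqP => j _.
  apply: (leq_trans (size_scale_leq _ _)).
  apply: (leq_trans (size_sum _ _ _)); apply/bigmax_leqP => i _.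
  apply: (leq_trans (size_scale_leq _ _)); rewrite size_polyXn.
  by have := ltn_ord j; lia.
rewrite big_ord_recr /= coefD pe scale1r coef_sum big1 => [|j _].
  rewrite add0r coef_sum big_ord_recl /= big1 => [|i _].
    by rewrite coefZ coefXn subn0 eqxx mulr1 addr0 expr0 mulmx1.
  rewrite coefZ coefXn /= gtn_eqF ?mulr0 //.
  by have := ltn_ord i; rewrite /bump; lia.
rewrite coefZ coef_sum big1 ?mulr0 // => i _.
rewrite coefZ coefXn gtn_eqF ?mulr0 //.
by have := ltn_ord i; have := ltn_ord j; lia.
Qed.

(** Multiplying (X - A) B = m by the adjugate of X - A turns
    v^T adj(X - A) u into chi * w / m inside the rank-one determinant formula.
    The statement is multiplied by m so as to stay among polynomials. *)
Lemma annihilator_char_poly_rank1 (F : fieldType) (n : nat) (A : 'M[F]_n.+1)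
    (u v : 'cV[F]_n.+1) (m : {poly F}) (tau : F) :
  horner_mx A m = 0 ->
  m * char_poly (A + tau *: (u *m v^T))
  = char_poly A * (m - tau *: resolvent_form A u v m).
Proof.
move=> mA0; set w := resolvent_form A u v m.
pose U : 'cV[{poly F}]_n.+1 := map_mx polyC u.
pose V : 'rV[{poly F}]_n.+1 := map_mx polyC v^T.
have key : m *: \adj (char_poly_mx A) = char_poly A *: resolvent_numer A m.
  have := congr1 (mulmx (\adj (char_poly_mx A))) (mul_resolvent_numer A m).
  rewrite mulmxA mul_adj_mx mul_scalar_mx mA0.
  by rewrite map_mx0 subr0 mul_mx_scalar => ->.
have -> : char_poly (A + tau *: (u *m v^T))
    = char_poly A - tau%:P * (V *m \adj (char_poly_mx A) *m U) 0 0.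
  have chi0 : \det (char_poly_mx A) != 0 by exact/monic_neq0/char_poly_monic.
  rewrite /char_poly /char_poly_mx map_mxD map_mxZ map_mxM opprD addrA.
  rewrite scalemxAl det_sub_rank1 //.
  by rewrite -scalemxAr mxE.
rewrite !mulrBr (mulrC m); congr (_ - _).
rewrite -[tau *: w]mul_polyC !(mulrCA _ tau%:P); congr (_ * _).
have /(congr1 (fun B => (V *m B *m U) 0 0)) := key.
by rewrite -!scalemxAr -!scalemxAl [LHS]mxE [RHS]mxE.
Qed.

(** * Critical points of a quotient of polynomials *)

Lemma coef_mul_top (R : nzRingType) (p q : {poly R}) (a b : nat) :
  (size p <= a.+1)%N -> (size q <= b.+1)%N -> (p * q)`_(a + b) = p`_a * q`_b.
Proof.
move=> sp sq; rewrite coefM.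
have la : (a < (a + b).+1)%N by rewrite ltnS leq_addr.
rewrite (bigD1 (Ordinal la)) //= addKn big1 ?addr0 // => i.
rewrite -val_eqE /= neq_ltn => /orP[lt_ia|lt_ai].
  rewrite [q`__]nth_default ?mulr0 //; apply: leq_trans sq _.
  by move: lt_ia; lia.
by rewrite nth_default ?mul0r //; apply: leq_trans sp _.
Qed.

Definition wronskian (F : fieldType) (p q : {poly F}) : {poly F} :=
  p * q^`() - p^`() * q.

Lemma size_mulX_deriv (F : fieldType) (p : {poly F}) (d : nat) :
  (size p <= d.+1)%N -> (size ('X * p^`())%R <= d.+1)%N.
Proof.
move=> sp; apply/leq_sizeP => j dj; rewrite coefXM.
case: j dj => // j dj; rewrite coef_deriv /=.
by rewrite nth_default ?mul0rn // (leq_trans sp).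
Qed.

Lemma coef_mulX_deriv (F : fieldType) (p : {poly F}) (k : nat) :
  ('X * p^`())`_k = p`_k *+ k.
Proof. by rewrite coefXM; case: k => [|k]; rewrite ?mulr0n // coef_deriv. Qed.

(** Both products in the Wronskian are multiplied by X in the proof: the
    operator X d/dX keeps degrees and scales the coefficient of X^k by k, so
    that the top coefficient e q_e - (e + 1) q_e = - q_e appears uniformly in
    [e], including e = 0 where the derivative of [q] vanishes.  Because the two
    multipliers differ by exactly one, the result is nonzero in every
    characteristic. *)
Lemma size_wronskian (F : fieldType) (p q : {poly F}) (e : nat) :
  p \is monic -> size p = e.+2 -> (size q <= e.+1)%N -> q`_e != 0 ->
  wronskian p q != 0 /\ (size (wronskian p q) <= (2 * e).+1)%N.
Proof.
move=> /monicP lp sp sq qe; have pe : p`_e.+1 = 1 by rewrite -lp lead_coefE sp.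
have sp' : (size p <= e.+2)%N by rewrite sp.
have XW : 'X * wronskian p q = p * ('X * q^`()) - ('X * p^`()) * q.
  by rewrite /wronskian; ring.
have top : ('X * wronskian p q)`_(e.+1 + e) = - q`_e.
  rewrite XW coefB !coef_mul_top ?size_mulX_deriv // !coef_mulX_deriv pe mul1r.
  by rewrite mulr_natl mulrSr opprD addrA subrr add0r.
have W0 : wronskian p q != 0.
  apply: contra_neq qe => W0; move: top; rewrite W0 mulr0 coef0 => /esym/eqP.
  by rewrite oppr_eq0 => /eqP.
split=> //.
have le (a b : {poly F}) : (size a <= e.+2)%N -> (size b <= e.+1)%N ->
    (size (a * b)%R <= (2 * e).+2)%N.
  move=> sa sb; apply: (leq_trans (size_polyMleq _ _)).
  by move: sa sb; lia.
have: (size ('X * wronskian p q)%R <= (2 * e).+2)%N.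
  rewrite XW; apply: (leq_trans (size_polyD _ _)); rewrite geq_max size_polyN.
  by rewrite !le ?size_mulX_deriv.
by rewrite mulrC size_mulX.
Qed.

(** A double root x gives p(x) = tau q(x) and p'(x) = tau q'(x), so the two
    vectors (p, p') and (q, q') at x are proportional; q(x) cannot vanish since
    p(x) would vanish with it. *)
Lemma double_root_pencil (F : fieldType) (p q : {poly F}) (tau x : F) :
  ~~ root p x -> ('X - x%:P) ^+ 2 %| p - tau *: q ->
  root (wronskian p q) x /\ tau = p.[x] / q.[x].
Proof.
move=> px0 /dvdpP[r Er].
have Ep : p = r * ('X - x%:P) ^+ 2 + tau *: q by rewrite -Er subrK.
have px : p.[x] = tau * q.[x].
  by rewrite Ep hornerD hornerM horner_exp hornerXsubC subrr expr0n mulr0 add0r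
    hornerZ.
have dpx : p^`().[x] = tau * q^`().[x].
  rewrite Ep derivD derivZ derivM expr2 derivM derivXsubC mulr1 mul1r.
  by rewrite !(hornerXsubC, hornerD, hornerM, hornerZ) subrr !(mulr0, addr0, add0r).
have qx0 : q.[x] != 0.
  by apply: contraNneq px0 => qx0; rewrite rootE px qx0 mulr0.
split; last by rewrite px mulfK.
by rewrite rootE /wronskian !hornerE px dpx; apply/eqP; ring.
Qed.

(** * Counting and genericity *)

Lemma card_le_image_roots (F : closedFieldType) (T : Type) (p : {poly F})
    (f : F -> T) (S : set T) (k : nat) :
  p != 0 -> (size p <= k.+1)%N ->
  (forall t, S t -> exists2 x, root p x & t = f x) -> S #<= `I_k.
Proof.
move=> p0 sp Sf; have [r Er] := closed_field_poly_normal p.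
have lp0 : lead_coef p != 0 by rewrite lead_coef_eq0.
have sr : (size r <= k)%N.
  by move: sp; rewrite Er size_scale // size_prod_XsubC ltnS.
(* Roots are listed by their index in r; padding with the default value of nth
   up to k only enlarges the image. *)
apply: card_le_trans (card_image_le (fun i => f r`_i) `I_k).
apply: subset_card_le => t /Sf[x + ->].
rewrite Er rootZ // root_prod_XsubC => xr.
exists (index x r); last by rewrite nth_index.
by rewrite /= (leq_trans _ sr) // index_mem.
Qed.

(** The complement is a quadric, and it misses the point whose two halves are
    both the first basis vector. *)
Lemma generic_dot_neq0 (F : fieldType) (n : nat) :
  generic [set x : 'cV[F]_(n.+1 + n.+1) |
            ((dsubmx x)^T *m usubmx x) 0 0 != 0].
Proof.
set Om := [set x | _].
have wit : Om (col_mx (delta_mx 0 0) (delta_mx 0 0)).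
  rewrite /Om /= col_mxKu col_mxKd trmx_delta mul_delta_mx mxE !eqxx.
  exact: oner_neq0.
split; first by exists (col_mx (delta_mx 0 0) (delta_mx 0 0)).
exists (~` Om); split; last exact: subset_refl.
  pose P : {mpoly F[n.+1 + n.+1]} :=
    \sum_(i < n.+1) 'X_(rshift n.+1 i) * 'X_(lshift n.+1 i).
  exists [set P]; apply/seteqP; split=> x.
    move=> /negP; rewrite negbK => /eqP x0 _ ->.
    rewrite -[RHS]x0 mxE /P rmorph_sum; apply: eq_bigr => i _ /=.
    by rewrite mevalM !mevalXU !mxE.
  move=> /(_ P erefl) Px; apply/negP; rewrite negbK -Px mxE /P rmorph_sum.
  by apply/eqP; apply: eq_bigr => i _ /=; rewrite mevalM !mevalXU !mxE.
move=> E; have : (~` Om) (col_mx (delta_mx 0 0) (delta_mx 0 0)) by rewrite E.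
by apply.
Qed.

Theorem theorem6p1 (R : realType) (n : nat) (A : 'M[R[i]]_n.+1) :
  exists Omega : set 'cV[R[i]]_(n.+1 + n.+1),
    generic Omega /\
    forall u v : 'cV[R[i]]_n.+1, Omega (col_mx u v) ->
      [set tau : R[i] | exists lambda : R[i],
         [/\ eigenvalue (A + tau *: (u *m v^T)) lambda,
             (2 <= mup lambda (char_poly (A + tau *: (u *m v^T))))%N
           & ~~ eigenvalue A lambda]]
      #<= `I_(2 * (size (mxminpoly A)).-1 - 2).
Proof.
eexists; split; first exact: generic_dot_neq0.
move=> u v; rewrite /= col_mxKu col_mxKd => uv0.
set m := mxminpoly A; pose w := resolvent_form A u v m.
have [e sm] : exists e, size m = e.+2.
  rewrite size_mxminpoly; case: degree_mxminpoly (mxminpoly_nonconstant A) => //.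
  by move=> e _; exists e.
have m_monic : m \is monic := mxminpoly_monic A.
have [sw we] := resolvent_form_top A u v m_monic sm.
have we0 : w`_e != 0 by rewrite we.
have [W0 sW] := size_wronskian m_monic sm sw we0.
rewrite sm /= mulnS addKn.
apply: (card_le_image_roots (f := fun x => m.[x] / w.[x]) W0 sW).
move=> tau [x [_ mult not_eig]].
have [Wx tauE] : root (wronskian m w) x /\ tau = m.[x] / w.[x].
  apply: double_root_pencil; first by rewrite -eigenvalue_root_min.
  (* char_poly A does not vanish at x, so the double root of
     char_poly A * (m - tau *: w) at x comes from the second factor. *)
  rewrite -(@Gauss_dvdpr _ _ (char_poly A)); last first.
    by rewrite coprimep_pexpl // coprimep_sym coprimep_XsubC
      -eigenvalue_root_char.
  rewrite -annihilator_char_poly_rank1 ?mx_root_minpoly // dvdp_mull //.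
  by rewrite -mup_geq // monic_neq0 // char_poly_monic.
by exists x.
Qed.
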